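(* Let $X,Y$ be real-valued random variables with continuous cumulative distribution functions $F$ and $G$ respectively, and let $C$ be a bivariate copula of $(X,Y)$, i.e. $\mathbb{P}(X\le x,\,Y\le y)=C(F(x),G(y))$ for all $x,y\in\mathbb{R}$. Then the generalized upper tail dependence $\tilde\lambda_U$ of $C$ is equivalent to the standard upper tail dependence parameter $\lambda_U$, that is, the limit defining $\tilde\lambda_U$ exists if and only if the limit defining $\lambda_U$ exists, and in that case $\tilde\lambda_U=\lambda_U$. Likewise, the generalized lower tail dependence $\tilde\lambda_L$ of $C$ is equivalent to the standard lower tail dependence parameter $\lambda_L$, that is, the limit defining $\tilde\lambda_L$ exists if and only if the limit defining $\lambda_L$ exists, and in that case $\tilde\lambda_L=\lambda_L$.
   Context: A bivariate copula is a function $C:[0,1]^2\to[0,1]$ such that for all $u,v\in[0,1]$: $C(0,u)=0=C(u,0)$, $C(1,u)=u=C(u,1)$, $C(u,v)=C(v,u)$ (symmetry is part of the definition used here), and such that for all $u_1\le u_2$ and $v_1\le v_2$ in $[0,1]$, $$C(u_2,v_2)-C(u_2,v_1)-C(u_1,v_2)+C(u_1,v_1)\ge 0.$$ The $C$-volume of a rectangle $[u_1,u_2]\times[v_1,v_2]\subseteq[0,1]^2$ is $$V_C([u_1,u_2]\times[v_1,v_2])=C(u_2,v_2)-C(u_2,v_1)-C(u_1,v_2)+C(u_1,v_1).$$ Generalized tail dependence of $C$: $$\tilde\lambda_U:=\lim_{t\to1^-}\frac{V_C([t,1]\times[t,1])}{1-t},\qquad \tilde\lambda_L:=\lim_{t\to0^+}\frac{V_C([0,t]\times[0,t])}{t}.$$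 Standard tail dependence parameters: with the generalized inverses $F^{(-1)}(t)=\inf\{x\in\mathbb{R}:F(x)\ge t\}$ and $G^{(-1)}(t)=\inf\{y\in\mathbb{R}:G(y)\ge t\}$ for $t\in(0,1)$, $$\lambda_U:=\lim_{t\to1^-}\mathbb{P}\big(Y>G^{(-1)}(t)\,\big|\,X>F^{(-1)}(t)\big)=\lim_{t\to1^-}\left(2-\frac{1-C(t,t)}{1-t}\right),$$ $$\lambda_L:=\lim_{t\to0^+}\mathbb{P}\big(Y\le G^{(-1)}(t)\,\big|\,X\le F^{(-1)}(t)\big)=\lim_{t\to0^+}\frac{C(t,t)}{t}.$$ *)

(* Defs.v *)
From HB Require Import structures.
From mathcomp Require Import all_boot all_order all_algebra.
From mathcomp Require Import all_classical all_reals all_analysis.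

Set Implicit Arguments.
Unset Strict Implicit.
Unset Printing Implicit Defensive.

Import Order.TTheory GRing.Theory Num.Theory.
Import numFieldNormedType.Exports.

Local Open Scope classical_set_scope.
Local Open Scope ring_scope.

(* The C-volume of [u1, u2] x [v1, v2]. *)
Definition Cvolume (R : realType) (C : R -> R -> R) (u1 u2 v1 v2 : R) : R :=
  C u2 v2 - C u2 v1 - C u1 v2 + C u1 v1.

(* A function on [0,1]^2 is represented by a total C : R -> R -> R which is
   only constrained (and only used) on the unit square. Symmetry is part of
   the notion of copula considered here. *)
Record is_copula (R : realType) (C : R -> R -> R) : Prop := IsCopula {
  copula_range : forall u v : R, 0 <= u <= 1 -> 0 <= v <= 1 -> 0 <= C u v <= 1;
  copula_0l : forall u : R, 0 <= u <= 1 -> C 0 u = 0;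
  copula_0r : forall u : R, 0 <= u <= 1 -> C u 0 = 0;
  copula_1l : forall u : R, 0 <= u <= 1 -> C 1 u = u;
  copula_1r : forall u : R, 0 <= u <= 1 -> C u 1 = u;
  copula_sym : forall u v : R, 0 <= u <= 1 -> 0 <= v <= 1 -> C u v = C v u;
  copula_2incr : forall u1 u2 v1 v2 : R,
    0 <= u1 -> u1 <= u2 -> u2 <= 1 -> 0 <= v1 -> v1 <= v2 -> v2 <= 1 ->
    0 <= Cvolume C u1 u2 v1 v2 }.

(* The library's cdf takes values in \bar R; this is its real-valued version. *)
Definition rcdf d (T : measurableType d) (R : realType) (P : probability T R)
    (X : {RV P >-> R}) (x : R) : R :=
  fine (cdf X x).

Definition copula_of d (T : measurableType d) (R : realType)
    (P : probability T R) (X Y : {RV P >-> R}) (C : R -> R -> R) : Prop :=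
  is_copula C /\
  forall x y : R, P [set w | X w <= x /\ Y w <= y] = (C (rcdf X x) (rcdf Y y))%:E.

Definition geninv (R : realType) (F : R -> R) (t : R) : R :=
  inf [set x : R | t <= F x].

(* Elementary conditional probability of A given B; it is 0 if P B = 0. *)
Definition condprob d (T : measurableType d) (R : realType)
    (P : probability T R) (A B : set T) : R :=
  fine (P (A `&` B)) / fine (P B).

(* The four functions of t whose one-sided limits (at 1 from the left for the
   upper ones, at 0 from the right for the lower ones) define the generalized
   and the standard tail dependence parameters. *)
Definition gen_upper_tail (R : realType) (C : R -> R -> R) (t : R) : R :=
  Cvolume C t 1 t 1 / (1 - t).

Definition gen_lower_tail (R : realType) (C : R -> R -> R) (t : R) : R :=
  Cvolume C 0 t 0 t / t.

Definition std_upper_tail d (T : measurableType d) (R : realType)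
    (P : probability T R) (X Y : {RV P >-> R}) (t : R) : R :=
  condprob P [set w | geninv (rcdf Y) t < Y w] [set w | geninv (rcdf X) t < X w].

Definition std_lower_tail d (T : measurableType d) (R : realType)
    (P : probability T R) (X Y : {RV P >-> R}) (t : R) : R :=
  condprob P [set w | Y w <= geninv (rcdf Y) t] [set w | X w <= geninv (rcdf X) t].

(* Main.v *)
Require Import Defs.
From HB Require Import structures.
From mathcomp Require Import all_boot all_order all_algebra.
From mathcomp Require Import all_classical all_reals all_analysis.
From mathcomp Require Import lra.

(* A continuous cdf F takes every value t in (0, 1), and F (F^(-1) t) = t there.
   Hence, writing events {X > F^(-1) t} through complements, the conditional
   probabilities agree on (0, 1) with the normalised C-volumes; the two families
   of limits are then limits of functions that coincide near the endpoint. *)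

Set Implicit Arguments.
Unset Strict Implicit.
Unset Printing Implicit Defensive.

Import Order.TTheory GRing.Theory Num.Theory.
Import numFieldNormedType.Exports.

Local Open Scope classical_set_scope.
Local Open Scope ring_scope.

(** Stated as an equality of image filters, so that a single rewriting transfers both [cvg] and
    [lim]. *)
Lemma near_eq_fmap (T U : Type) (F : set_system T) (FF : Filter F)
    (f g : T -> U) : {near F, f =1 g} -> f @ F = g @ F.
Proof.
move=> fg; apply/seteqP; split; apply: near_eq_cvg => //.
by apply: filterS fg => x ->.
Qed.

Lemma geninvK (R : realType) (F : R -> R) (t : R) :
  nondecreasing F -> continuous F -> F x @[x --> -oo] --> (0 : R) ->
  F x @[x --> +oo] --> (1 : R) -> 0 < t < 1 -> F (geninv F t) = t.
Proof.
move=> ndF cF F0 F1 /andP[t0 t1].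
have /filter_ex[a Fat] : \forall a \near -oo, F a < t by exact: (cvgr_lt _ F0).
have /filter_ex[b Ftb] : \forall b \near +oo, t < F b by exact: (cvgr_gt _ F1).
have ab : a <= b.
  rewrite leNgt; apply/negP => /ltW /ndF; rewrite leNgt => /negP; apply.
  exact: lt_trans Ftb.
have [c _ Fc] : exists2 c, c \in `[a, b] & F c = t.
  apply: IVT => //; first exact: continuous_subspaceT.
  by rewrite ge_min le_max (ltW Fat) (ltW Ftb) orbT.
pose S := [set x | t <= F x].
(* [inf] is a genuine infimum only for a nonempty set that is bounded below: [c] is a point of [S]
   and [a] is a lower bound. *)
have lbS : lbound S a.
  move=> x /= tFx; rewrite leNgt; apply/negP => /ltW /ndF.
  by rewrite leNgt (lt_le_trans Fat).
have infS : has_inf S by split; [exists c; rewrite /S/= Fc|exists a].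
apply/eqP; rewrite eq_le; apply/andP; split.
  rewrite -[leRHS]Fc; apply: ndF; apply: ge_inf; first by exists a.
  by rewrite /= Fc.
(* Otherwise [F] stays below [t] on a ball around the infimum, yet that ball contains a point of
   [S]. *)
rewrite leNgt; apply/negP => Fmt.
have /nbhs_ballP[e /= e0 me] : \forall x \near geninv F t, F x < t.
  exact: (cvgr_lt _ (cF (geninv F t))).
have [x Sx xme] := inf_adherent e0 infS.
have mx : geninv F t <= x by apply: ge_inf => //; exists a.
have : F x < t.
  apply: me; rewrite /ball/= distrC ger0_norm ?subr_ge0//.
  by rewrite ltrBlDl.
by rewrite ltNge => /negP; apply.
Qed.

Section rcdf.
Context d (T : measurableType d) (R : realType) (P : probability T R).
Implicit Types X Y : {RV P >-> R}.

Lemma rcdfE X x : P [set w | X w <= x] = (rcdf X x)%:E.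
Proof.
rewrite /rcdf fineK; last exact: fin_num_measure.
by rewrite /cdf /distribution /pushforward set_itvE.
Qed.

Lemma geninv_rcdfK X t : continuous (rcdf X) -> 0 < t < 1 ->
  rcdf X (geninv (rcdf X) t) = t.
Proof.
move=> cX; apply: geninvK => //.
- by move=> x y xy; rewrite fine_le ?fin_num_measure// cdf_nondecreasing.
- exact/fine_cvg/cvg_cdfNy0.
- exact/fine_cvg/cvg_cdfy1.
Qed.

Lemma measurable_RV_le X x : measurable [set w | X w <= x].
Proof.
rewrite (_ : [set _ | _] = X @^-1` `]-oo, x]); first exact: measurable_funPTI.
by apply/seteqP; split=> w /=; rewrite in_itv.
Qed.

Lemma setC_RV_le X x : [set w | x < X w] = ~` [set w | X w <= x].
Proof. by apply/seteqP; split=> w /=; rewrite ltNge => /negP. Qed.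

Lemma prob_RV_gt X x : P [set w | x < X w] = (1 - rcdf X x)%:E.
Proof.
rewrite setC_RV_le probability_setC; last exact: measurable_RV_le.
by rewrite rcdfE -EFinB.
Qed.

(** Inclusion-exclusion for the two complements. Cutting [B] along [A], and the complement of [A]
    along [B], gives two equations that share the term [P (B \ A)]. *)
Lemma copula_prob_gt X Y C x y : copula_of X Y C ->
  P [set w | x < X w /\ y < Y w] =
  (1 - rcdf X x - rcdf Y y + C (rcdf X x) (rcdf Y y))%:E.
Proof.
move=> [_ XYC].
pose A := [set w | X w <= x]; pose B := [set w | Y w <= y].
have mA : measurable A := measurable_RV_le X x.
have mB : measurable B := measurable_RV_le Y y.
have -> : [set w | x < X w /\ y < Y w] = ~` A `\` B by rewrite setDE -!setC_RV_le.
have PDI (E F : set T) : measurable E -> measurable F ->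
  P E = (P (E `\` F) + P (E `&` F))%E := @measureDI _ _ _ P E F.
have PB : (rcdf Y y)%:E = (P (B `\` A) + (C (rcdf X x) (rcdf Y y))%:E)%E.
  by rewrite -rcdfE -XYC [LHS](PDI _ _ mB mA) [B `&` A]setIC.
have PA : (1 - rcdf X x)%:E = (P (~` A `\` B) + P (B `\` A))%E.
  rewrite -prob_RV_gt setC_RV_le [LHS](PDI _ _ (measurableC mA) mB).
  by rewrite [in X in (_ + X)%E]setIC.
move: PA PB.
(* Both unknown probabilities are finite, so the equations descend to real linear ones, from which
   the shared term is eliminated. *)
have /fineK <- : P (B `\` A) \is a fin_num.
  by apply: fin_num_measure; exact: measurableD.
have /fineK <- : P (~` A `\` B) \is a fin_num.
  by apply: fin_num_measure; apply: measurableD => //; exact: measurableC.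
by rewrite -!EFinD => -[PA] [PB]; congr EFin; lra.
Qed.

End rcdf.

Theorem lemma3p1 (R : realType) (d : measure_display) (T : measurableType d)
    (P : probability T R) (X Y : {RV P >-> R}) (C : R -> R -> R)
    (cF : continuous (rcdf X)) (cG : continuous (rcdf Y))
    (CXY : copula_of X Y C) :
  ((cvg (gen_upper_tail C t @[t --> 1^'-]) <->
      cvg (std_upper_tail X Y t @[t --> 1^'-])) /\
   (cvg (gen_upper_tail C t @[t --> 1^'-]) ->
      lim (gen_upper_tail C t @[t --> 1^'-]) =
      lim (std_upper_tail X Y t @[t --> 1^'-]))) /\
  ((cvg (gen_lower_tail C t @[t --> 0^'+]) <->
      cvg (std_lower_tail X Y t @[t --> 0^'+])) /\
   (cvg (gen_lower_tail C t @[t --> 0^'+]) ->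
      lim (gen_lower_tail C t @[t --> 0^'+]) =
      lim (std_lower_tail X Y t @[t --> 0^'+]))).
Proof.
have [HC HXY] := CXY.
have upper : gen_upper_tail C t @[t --> 1^'-] = std_upper_tail X Y t @[t --> 1^'-].
  apply: near_eq_fmap; near=> t.
  have t01 : 0 < t < 1.
    by apply/andP; split; near: t; [exact: nbhs_left_gt|exact: nbhs_left_lt].
  have t01' : 0 <= t <= 1 by case/andP: t01 => /ltW -> /ltW ->.
  (* Both quotients have denominator [1 - t]. The joint tail probability is [1 - t - t + C t t],
     which is the volume of the upper corner square because [C 1 1 = 1] and [C 1 t = C t 1 = t]. *)
  rewrite /gen_upper_tail /std_upper_tail /condprob prob_RV_gt.
  rewrite setIC (copula_prob_gt _ _ CXY) !geninv_rcdfK//= /Cvolume.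
  by rewrite !(copula_1l HC, copula_1r HC) ?ler01 ?lexx.
have lower : gen_lower_tail C t @[t --> 0^'+] = std_lower_tail X Y t @[t --> 0^'+].
  apply: near_eq_fmap; near=> t.
  have t01 : 0 < t < 1.
    by apply/andP; split; near: t; [exact: nbhs_right_gt|exact: nbhs_right_lt].
  have t01' : 0 <= t <= 1 by case/andP: t01 => /ltW -> /ltW ->.
  (* Since [C] vanishes on the axes, the volume of the lower corner square is [C t t], the joint
     probability itself. *)
  rewrite /gen_lower_tail /std_lower_tail /condprob rcdfE setIC.
  rewrite [_ `&` _]/= HXY !geninv_rcdfK//= /Cvolume.
  rewrite !(copula_0l HC, copula_0r HC) ?ler01 ?lexx//.
  by rewrite !subr0 addr0.
by rewrite upper lower.
Unshelve. all: by end_near.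
Qed.
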